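(* Let $\tau=\frac1r\left(-\frac{d}{dx}p\frac{d}{dx}+q\right)$ on $(a,b)$ with $p,q,r$ real-valued, $p,r>0$, $p^{-1},q,r\in L^1_{loc}(a,b)$, where $a$ is a regular endpoint and $b$ is limit point. Let $\lambda\in\mathbb{R}$. Suppose that for any solution $u$ of $\tau u=\lambda u$ there exists a constant $C=C(u)$ for which $$\limsup_{x\to b}\frac1x\int_a^x\frac{|pu'(y)|^2}{r(y)}\,dy\le C\,\limsup_{x\to b}\frac1x\int_a^x|u(y)|^2r(y)\,dy .$$ If, in addition, $x^{-1}\|u\|_{(a,x)}^2$ is bounded for every solution $u$ of $\tau u=\lambda u$, then $\lambda\in N(\tau)$.
   Context: Solutions of $\tau u=\lambda u$ are functions $u$ with $u,pu'$ locally absolutely continuous and $-(pu')'+qu=\lambda r u$ a.e. The endpoint $a$ is regular if it is finite and $p^{-1},q,r$ are integrable near $a$; $b$ is limit point if for some (equivalently every) $z\in\mathbb{C}$ not all solutions of $\tau u=zu$ are in $L^2(r\,dx)$ near $b$. Here $\|f\|_{(a,x)}=\left(\int_a^x|f(y)|^2r(y)\,dy\right)^{1/2}$. A nonzero solution $u$ of $\tau u=\lambda u$ is called subordinate at $b$ with respect to another solution $v$ if $\lim_{x\to b}\|u\|_{(a,x)}/\|v\|_{(a,x)}=0$; it is called subordinate at $b$ if this holds with respect to some (equivalently, any) linearly independent solution $v$. $N(\tau)=\{\lambda\in\mathbb{R}\mid \text{no solution of }\tau u=\lambda u\text{ is subordinate at }b\}$. *)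

(* Defs.v *)
From HB Require Import structures.
From mathcomp Require Import all_boot all_order all_algebra.
From mathcomp Require Import all_classical all_reals all_analysis.
From mathcomp Require Import complex.

Set Implicit Arguments.
Unset Strict Implicit.
Unset Printing Implicit Defensive.

Import Order.TTheory GRing.Theory Num.Theory.
Import numFieldNormedType.Exports.

Local Open Scope classical_set_scope.
Local Open Scope ring_scope.
Local Open Scope complex_scope.

Section FunctionsOfARealVariable.
Context {R : realType}.
Implicit Types (a c d x : R) (b : \bar R).

Definition abs2 (z : R[i]) : R := Normc.normc z ^+ 2.

(* the interval (a, b), where b may be +oo *)
Definition oint a b : set R := [set x | a < x /\ (x%:E < b)%E].

(* The filter of x -> b, x < b. The last branch is never used: b lies above a
   real number. *)
Definition to_right_end b : set_system R :=
  match b with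
  | c%:E => c^'-
  | +oo => pinfty_nbhs R
  | -oo => ninfty_nbhs R
  end%E.

Definition abs_continuous c d (f : R -> R[i]) : Prop :=
  forall e : R, 0 < e -> exists2 delta : R, 0 < delta &
    forall (n : nat) (s t : 'I_n -> R),
      (forall i, [/\ c <= s i, s i <= t i & t i <= d]) ->
      (forall i j, i != j -> t i <= s j \/ t j <= s i) ->
      \sum_(i < n) (t i - s i) < delta ->
      \sum_(i < n) Normc.normc (f (t i) - f (s i)) < e.

Definition loc_abs_continuous a b (f : R -> R[i]) : Prop :=
  forall c d, a < c -> c <= d -> (d%:E < b)%E -> abs_continuous c d f.

Definition is_cderive x (f : R -> R[i]) (l : R[i]) : Prop :=
  is_derive x (1 : R) (fun y => complex.Re (f y)) (complex.Re l) /\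
  is_derive x (1 : R) (fun y => complex.Im (f y)) (complex.Im l).

End FunctionsOfARealVariable.

Section SturmLiouville.
Context {R : realType}.
Variables (a : R) (b : \bar R) (p q r : R -> R).
Implicit Types (z : R[i]) (lambda : R) (u v : R -> R[i]).
Local Notation mu := (@lebesgue_measure R).

(* Since u is only differentiable almost everywhere, "pu' is locally absolutely
   continuous" means that pu' has a (unique) locally absolutely continuous
   representative pu'; that representative is the argument pu'. *)
Definition is_solution z u (pu' : R -> R[i]) : Prop :=
  [/\ loc_abs_continuous a b u,
      loc_abs_continuous a b pu',
      {ae mu, forall x, oint a b x ->
         exists2 u'x, is_cderive x u u'x & pu' x = (p x)%:C * u'x} &
      {ae mu, forall x, oint a b x ->
         exists2 l, is_cderive x pu' l &
           - l + (q x)%:C * u x = z * (r x)%:C * u x}].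

Definition solution z u : Prop := exists pu', is_solution z u pu'.

Definition regular_left : Prop :=
  exists2 c, oint a b c &
    [/\ mu.-integrable `]a, c[ (fun x => ((p x)^-1)%:E),
        mu.-integrable `]a, c[ (fun x => (q x)%:E) &
        mu.-integrable `]a, c[ (fun x => (r x)%:E)].

Definition L2_near_right u : Prop :=
  exists2 c, oint a b c &
    (\int[mu]_(x in oint c b) (abs2 (u x) * r x)%:E < +oo)%E.

Definition limit_point_right : Prop :=
  exists z, ~ (forall u, solution z u -> L2_near_right u).

Definition sqnorm u (x : R) : \bar R :=
  (\int[mu]_(y in `]a, x[) (abs2 (u y) * r y)%:E)%E.

(* For a solution u the integral is finite, because a is regular and x < b;
   [fine] therefore loses nothing. *)
Definition norm_upto u (x : R) : R := Num.sqrt (fine (sqnorm u x)).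

Definition subordinate_wrt u v : Prop :=
  norm_upto u x / norm_upto v x @[x --> to_right_end b] --> (0 : R).

Definition lin_indep u v : Prop :=
  forall c1 c2 : R[i],
    (forall x, oint a b x -> c1 * u x + c2 * v x = 0) -> c1 = 0 /\ c2 = 0.

Definition subordinate z u : Prop :=
  [/\ solution z u,
      exists2 x, oint a b x & u x != 0 &
      exists v, [/\ solution z v, lin_indep u v & subordinate_wrt u v]].

Definition N_tau : set R :=
  [set lambda | ~ exists u, subordinate lambda%:C u].

(* \int_a^x |pu'|^2 / r may be +oo, as 1/r need not be locally integrable. *)
Definition sqnorm_inv (f : R -> R[i]) (x : R) : \bar R :=
  (\int[mu]_(y in `]a, x[) (abs2 (f y) / r y)%:E)%E.

End SturmLiouville.

(* Main.v *)
(** Let [u] be subordinate with respect to a linearly independent solution [v].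
    The Wronskian [w = u pv' - pu' v] is a nonzero constant.  Since
    [||v||^2 / x] is bounded, [||u||^2 / x -> 0].  If [b] is finite, this forces
    [||u|| -> 0], although [||u||] is nondecreasing and eventually positive.
    If [b = +oo], the growth hypothesis gives [x^-1 int |pu'|^2 / r -> 0] and
    [x^-1 int |pv'|^2 / r] bounded, so that integrating [w] over [(a, x)],
    applying Cauchy-Schwarz and dividing by [x] yields [w = 0].

    Solutions are absolutely continuous and differentiable almost everywhere
    only.  Both the constancy of the Wronskian and the uniqueness theorem behind
    [w <> 0] (Gronwall) follow from one fact: an absolutely continuous function
    whose derivative is almost everywhere nonnegative is nondecreasing. *)

Require Import Defs.
From HB Require Import structures.
From mathcomp Require Import all_boot all_order all_algebra.
From mathcomp Require Import all_classical all_reals all_analysis.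
From mathcomp Require Import complex.
From mathcomp Require Import measurable_realfun ring lra.

Set Implicit Arguments.
Unset Strict Implicit.
Unset Printing Implicit Defensive.

Import Order.TTheory GRing.Theory Num.Theory.
Import numFieldNormedType.Exports.

Local Open Scope classical_set_scope.
Local Open Scope ring_scope.
Local Open Scope complex_scope.

(** * Absolutely continuous functions *)

Section AbsoluteContinuity.
Context {R : realType}.
Implicit Types (c d e x y z : R) (f g h : R -> R) (L : seq (R * R)).
Local Notation mu := (@lebesgue_measure R).

(** Real induction: some point satisfying [P] lies within [eta] of the supremum of all such points,
    and a single step carries [P] from there to a point beyond the supremum, unless the supremum is
    [d]. *)
Lemma cousin_ind c d (P : R -> Prop) : c <= d -> P c ->
  (forall z, c <= z <= d -> exists2 eta : R, 0 < eta &
     forall x y, c <= x -> x <= z -> z <= y -> y <= d ->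
       z - x < eta -> y - z < eta -> P x -> P y) ->
  P d.
Proof.
move=> cd Pc step.
pose S := [set x | c <= x <= d /\ P x].
have Sc : S c by split=> //; rewrite lexx.
have ubS : ubound S d by move=> x [/andP[]].
have hsS : has_sup S by split; [exists c | exists d].
have cz : c <= sup S by apply: ub_le_sup => //; exists d.
have zd : sup S <= d by apply: ge_sup => //; exists c.
have [|eta eta0 steps] := step (sup S); first by rewrite cz.
have [x [/andP[cx xd] Px] xz] := sup_adherent eta0 hsS.
have xS : x <= sup S by apply: ub_le_sup; [exists d | split=> //; rewrite cx].
pose y := Num.min d (sup S + eta / 2).
have zy : sup S <= y by rewrite le_min zd; lra.
have yd : y <= d by rewrite ge_min lexx.
have yz : y <= sup S + eta / 2 by rewrite ge_min lexx orbT.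
have Py : P y by apply: (steps x) => //; lra.
have : y <= sup S.
  by apply: ub_le_sup; [exists d | split=> //; rewrite yd (le_trans cz)].
move: yz zy yd Py; rewrite /y /Num.min; case: ifP => // _ *; lra.
Qed.

(** The intervals are listed from left to right, so that a family in [[c, x]] grows by appending an
    interval to the right of [x]. This fits inductions that sweep from left to right. *)
Definition chain c d L : bool :=
  all [pred i | [&& c <= i.1, i.1 <= i.2 & i.2 <= d]] L &&
  pairwise [rel i j | i.2 <= j.1] L.

Definition acont c d f : Prop := forall e, 0 < e ->
  exists2 delta : R, 0 < delta & forall L, chain c d L ->
    \sum_(i <- L) (i.2 - i.1) < delta -> \sum_(i <- L) `|f i.2 - f i.1| < e.

Lemma chain_widen c d c' d' L : c' <= c -> d <= d' ->
  chain c d L -> chain c' d' L.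
Proof.
move=> cc dd /andP[aL pL]; apply/andP; split => //.
by apply: sub_all aL => i /= /and3P[*]; apply/and3P; split; lra.
Qed.

Lemma chain_rcons c x y d L : c <= x -> x <= y -> y <= d ->
  chain c x L -> chain c d (rcons L (x, y)).
Proof.
move=> cx xy yd /andP[aL pL]; apply/andP; split.
  rewrite all_rcons /= cx xy yd /=; apply: sub_all aL => i /= /and3P[*].
  by apply/and3P; split; lra.
rewrite pairwise_rcons pL andbT; apply: sub_all aL => i /=.
by move=> /and3P[].
Qed.

Lemma acont_modulus c d f : acont c d f -> forall e, 0 < e ->
  exists2 delta : R, 0 < delta & forall s t, c <= s -> s <= t -> t <= d ->
    t - s < delta -> `|f t - f s| < e.
Proof.
move=> acf e /acf[delta delta0 H]; exists delta => // s t cs st td tsd.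
have := H [:: (s, t)]; rewrite !big_seq1 /chain /= cs st td; exact.
Qed.

(** With the modulus that belongs to the value 1, each step across a point raises the bound by at
    most 1. *)
Lemma acont_bounded c d f : c <= d -> acont c d f ->
  exists2 M : R, 0 <= M & forall x, c <= x -> x <= d -> `|f x| <= M.
Proof.
move=> cd acf.
have [delta delta0 H] := acont_modulus acf ltr01.
apply: (@cousin_ind c d (fun y => exists2 M : R, 0 <= M &
  forall x, c <= x -> x <= y -> `|f x| <= M)) => //.
  exists `|f c| => // x cx xc; suff -> : x = c by [].
  by apply/eqP; rewrite eq_le cx xc.
move=> z _; exists (delta / 2); first lra.
move=> x y cx xz zy yd xzd yzd [M M0 HM]; exists (M + 1); first lra.
move=> t ct ty; have [tx|xt] := leP t x; first by have := HM t ct tx; lra.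
have := H x t cx (ltW xt); have := HM x cx (lexx x) => ? ?.
have ? : `|f t - f x| < 1 by lra.
have := ler_normD (f t - f x) (f x); rewrite subrK; lra.
Qed.

(** The closure properties below all reduce to this comparison of increments. *)
Lemma acont_dom c d f g h B : acont c d f -> acont c d g ->
  (forall s t, c <= s -> s <= t -> t <= d ->
     `|h t - h s| <= B * (`|f t - f s| + `|g t - g s|)) ->
  acont c d h.
Proof.
move=> acf acg hB e e0.
(* [|B| + 1] is positive whatever the sign of [B]; the factor 2 in the next line shares [e] between
   the increments of [f] and those of [g]. *)
have B0 : 0 < `|B| + 1 by rewrite ltr_wpDl.
have e'0 : 0 < e / (2 * (`|B| + 1)) by rewrite divr_gt0 // mulr_gt0.
have [d1 d10 H1] := acf _ e'0; have [d2 d20 H2] := acg _ e'0.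
exists (Num.min d1 d2); first by rewrite lt_min d10.
move=> L cL; rewrite lt_min => /andP[/(H1 _ cL) l1 /(H2 _ cL) l2].
apply: (@le_lt_trans _ _ ((`|B| + 1) *
   (\sum_(i <- L) `|f i.2 - f i.1| + \sum_(i <- L) `|g i.2 - g i.1|))).
  rewrite -big_split /= mulr_sumr big_seq_cond [leRHS]big_seq_cond.
  apply: ler_sum => i; rewrite andbT => iL.
  have /andP[/allP/(_ _ iL) /= /and3P[i1 i2 i3] _] := cL.
  apply: le_trans (hB _ _ i1 i2 i3) _; apply: ler_wpM2r.
    by rewrite addr_ge0.
  by have := ler_norm B; lra.
rewrite mulrC -ltr_pdivlMr //.
have -> : e / (`|B| + 1) = e / (2 * (`|B| + 1)) + e / (2 * (`|B| + 1)).
  by field; apply: lt0r_neq0.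
lra.
Qed.

Lemma acontD c d f g : acont c d f -> acont c d g ->
  acont c d (fun x => f x + g x).
Proof.
move=> acf acg; apply: (@acont_dom _ _ _ _ _ 1 acf acg) => s t _ _ _.
by rewrite mul1r opprD addrACA ler_normD.
Qed.

Lemma acontM c d f g : c <= d -> acont c d f -> acont c d g ->
  acont c d (fun x => f x * g x).
Proof.
move=> cd acf acg.
have [M M0 HM] := acont_bounded cd acf; have [N N0 HN] := acont_bounded cd acg.
apply: (@acont_dom _ _ _ _ _ (M + N) acf acg) => s t cs st td.
have -> : f t * g t - f s * g s = (f t - f s) * g t + f s * (g t - g s) by ring.
apply: le_trans (ler_normD _ _) _; rewrite !normrM.
have gt : `|g t| <= N by apply: HN; lra.
have fs : `|f s| <= M by apply: HM; lra.
rewrite mulrDr; apply: lerD; last by apply: ler_wpM2r => //; lra.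
by rewrite mulrC; apply: ler_wpM2r => //; lra.
Qed.

Lemma acontZ c d k f : acont c d f -> acont c d (fun x => k * f x).
Proof.
move=> acf; apply: (@acont_dom _ _ f f _ `|k| acf acf) => s t _ _ _.
by rewrite -mulrBr normrM mulrDr lerDl mulr_ge0.
Qed.

(** Below a bound [M] of [f] the exponential is Lipschitz with constant [expR M], as
    [1 + x <= expR x] shows. *)
Lemma acont_expR c d f : c <= d -> acont c d f -> acont c d (expR \o f).
Proof.
move=> cd acf; have [M M0 HM] := acont_bounded cd acf.
have lip (s t : R) : s <= t -> t <= M ->
    `|expR t - expR s| <= expR M * (t - s).
  move=> st tM; rewrite ger0_norm ?subr_ge0 ?ler_expR //.
  have -> : expR s = expR t * expR (s - t) by rewrite -expRD addrCA subrr addr0.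
  apply: (@le_trans _ _ (expR t * (t - s))).
    rewrite -[X in X - _]mulr1 -mulrBr ler_wpM2l ?expR_ge0 //.
    by have := expR_ge1Dx (s - t); lra.
  by rewrite ler_wpM2r ?ler_expR ?subr_ge0.
apply: (@acont_dom _ _ f f _ (expR M) acf acf) => s t cs st td /=.
have fM x : c <= x -> x <= d -> f x <= M.
  by move=> cx xd; apply: le_trans (ler_norm _) (HM _ cx xd).
apply: (@le_trans _ _ (expR M * `|f t - f s|)); last first.
  by rewrite ler_wpM2l ?expR_ge0 // lerDl.
have [fst|fts] := leP (f s) (f t).
  by rewrite [X in _ <= _ * X]ger0_norm ?subr_ge0 //; apply: lip => //; apply: fM; lra.
rewrite distrC [X in _ <= _ * X]distrC [X in _ <= _ * X]ger0_norm.
  by apply: lip; [exact: ltW | apply: fM; lra].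
by rewrite subr_ge0 ltW.
Qed.

(** The increments on the two sides of [z] are estimated separately and added; this is why the
    interval has to contain [z], possibly as an endpoint. *)
Lemma is_derive_straddle f z l e : is_derive z (1 : R) f l -> 0 < e ->
  exists2 eta : R, 0 < eta & forall x y, x <= z -> z <= y ->
    z - x < eta -> y - z < eta -> (l - e) * (y - x) <= f y - f x.
Proof.
move=> [dfz dfl] e0.
have : t^-1 *: ((f \o shift z) (t *: (1 : R)) - f z) @[t --> 0^'] --> l.
  by rewrite -dfl; exact: dfz.
move=> /cvgrPdist_lt /(_ e e0) [eta /= eta0 H].
have {}H t : `|t| < eta -> t != 0 -> `|l - t^-1 * (f (t + z) - f z)| < e.
  move=> teta t0; have := H t; rewrite /= sub0r normrN => /(_ teta t0).
  by rewrite /GRing.scale /= mulr1.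
exists eta => // x y xz zy xeta yeta.
have right : (l - e) * (y - z) <= f y - f z.
  have [->|yz] := eqVneq y z; first by rewrite !subrr mulr0.
  have yz0 : 0 < y - z by rewrite subr_gt0 lt_neqAle eq_sym yz.
  have := H (y - z); rewrite subrK gtr0_norm // yeta gt_eqF // => /(_ isT isT).
  rewrite ltr_distlC => /andP[lt2 _]; rewrite -ler_pdivlMr // mulrC; lra.
have left : (l - e) * (z - x) <= f z - f x.
  have [->|xz'] := eqVneq x z; first by rewrite !subrr mulr0.
  have xz0 : 0 < z - x by rewrite subr_gt0 lt_neqAle xz'.
  have := H (x - z); rewrite subrK -opprB normrN gtr0_norm // xeta oppr_eq0.
  rewrite gt_eqF // => /(_ isT isT).
  rewrite invrN mulNr -mulrN opprB.
  rewrite ltr_distlC => /andP[lt2 _]; rewrite -ler_pdivlMr // mulrC; lra.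
have -> : (l - e) * (y - x) = (l - e) * (y - z) + (l - e) * (z - x) by ring.
lra.
Qed.

(* The exceptional null set lies in an open set of small measure. By Cousin's
   lemma [c, d] splits into pieces on which either the derivative controls the
   increment, or which lie in that open set; absolute continuity bounds the
   total increment over the latter. *)
Lemma acont_nondecreasing c d f : c <= d -> acont c d f ->
  {ae mu, forall x, c <= x <= d -> exists2 l, is_derive x (1 : R) f l & 0 <= l} ->
  f c <= f d.
Proof.
move=> cd acf [N [mN muN subN]].
apply/ler_addgt0Pr => e e0.
have [delta delta0 Hdelta] : exists2 delta : R, 0 < delta & forall L,
    chain c d L -> \sum_(i <- L) (i.2 - i.1) < delta ->
    \sum_(i <- L) `|f i.2 - f i.1| < e / 2 by apply: acf; lra.
have muN' : (mu N < +oo)%E by rewrite muN.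
have [U [oU NU muU]] := lebesgue_regularity_outer mN muN' delta0.
have mU : measurable U by exact: open_measurable.
have {}muU : (mu U < delta%:E)%E.
  apply: le_lt_trans muU.
  have mUN : measurable (U `\` N) by exact: measurableD.
  have := measureU2 mu mN mUN; rewrite setDUK // => /le_trans; apply.
  by rewrite [X in (X + _ <= _)%E](_ : _ = 0%E) ?add0e //; exact: muN.
(* The slack in the slope: it costs at most [e / 2] over [[c, d]], and the added 1 covers the case
   [c = d]. *)
pose k := e / (2 * (d - c + 1)).
have dc1 : 0 < d - c + 1 by lra.
have k0 : 0 < k by rewrite divr_gt0 // mulr_gt0.
(* [L] collects the pieces around exceptional points, all inside [U]. The half-open [[c, x[] is
   disjoint from the next piece [[x, y[], so lengths add up against the measure of [U]. *)
have [L [cL Lmu fL]] : exists L, [/\ chain c d L,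
    ((\sum_(i <- L) (i.2 - i.1))%:E <= mu (U `&` `[c, d[))%E &
    f c - f d <= k * (d - c) + \sum_(i <- L) `|f i.2 - f i.1|].
  apply: (@cousin_ind c d (fun x => exists L, [/\ chain c x L,
    ((\sum_(i <- L) (i.2 - i.1))%:E <= mu (U `&` `[c, x[))%E &
    f c - f x <= k * (x - c) + \sum_(i <- L) `|f i.2 - f i.1|])) => //.
    by exists [::]; split=> //; rewrite big_nil ?measure_ge0 // !subrr mulr0 addr0.
  move=> z /andP[cz zd]; have [Nz|Nz] := pselect (N z).
    have [eta /= eta0 ballU] := open_nbhs_nbhs (conj oU (NU _ Nz)) : nbhs z U.
    exists eta => // x y cx xz zy yd xeta yeta [L [cL Lmu fL]].
    exists (rcons L (x, y)); split.
    - by apply: chain_rcons cL => //; lra.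
    - rewrite big_rcons /= EFinD.
      have -> : (y - x)%:E = mu `[x, y[.
        by rewrite lebesgue_measure_itv /= lte_fin; case: ltP => // *; congr _%:E; lra.
      apply: (@le_trans _ _ (mu (U `&` `[c, x[) + mu `[x, y[)%E).
        by rewrite leeD2r.
      rewrite -measureU //; first last.
      + apply/seteqP; split=> // t /= [[_]]; rewrite !in_itv /= => /andP[_ tx].
        by rewrite leNgt tx.
      + exact: measurableI.
      apply: le_measure; rewrite ?inE; [|exact: measurableI|].
        by apply: measurableU => //; exact: measurableI.
      move=> t /= [[Ut]|]; rewrite !in_itv /= => /andP[t1 t2].
        by split=> //; rewrite ?in_itv /= t1 (lt_le_trans t2) // (le_trans xz).
      split; last by rewrite ?in_itv /= t2 (le_trans cx).
      by apply: ballU; rewrite /= ltr_distlC; apply/andP; split; lra.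
    - rewrite big_rcons /=.
      have -> : k * (y - c) = k * (x - c) + k * (y - x) by ring.
      have : 0 <= k * (y - x) by apply: mulr_ge0; lra.
      have := ler_norm (- (f y - f x)); rewrite normrN; lra.
  have [l fl l0] : exists2 l, is_derive z (1 : R) f l & 0 <= l.
    by apply: contrapT => nd; apply/Nz/subN => /=; rewrite cz zd => /(_ isT).
  have [eta eta0 H] := is_derive_straddle fl k0.
  exists eta => // x y cx xz zy yd xeta yeta [L [cL Lmu fL]].
  exists L; split; first by apply: chain_widen cL => //; lra.
    apply: le_trans Lmu _; apply: le_measure; rewrite ?inE; try exact: measurableI.
    move=> t /= [Ut]; rewrite !in_itv /= => /andP[t1 t2]; split=> //.
    by rewrite ?in_itv /= t1 (lt_le_trans t2) // (le_trans xz).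
  have := H x y xz zy xeta yeta.
  have -> : k * (y - c) = k * (x - c) + k * (y - x) by ring.
  have : 0 <= l * (y - x) by apply: mulr_ge0; lra.
  rewrite mulrBl; lra.
have : \sum_(i <- L) (i.2 - i.1) < delta.
  rewrite -lte_fin; apply: le_lt_trans Lmu _; apply: le_lt_trans muU.
  by apply: le_measure; rewrite ?inE //; exact: measurableI.
move=> /(Hdelta _ cL).
have : k * (d - c) <= e / 2.
  have -> : e / 2 = k * (d - c + 1) by rewrite /k; field; apply: lt0r_neq0.
  by rewrite ler_pM2l //; lra.
lra.
Qed.
End AbsoluteContinuity.

(** * Real first-order systems *)

(** Lets [filterS] and [filterS2] combine conditions that hold almost everywhere. *)
#[local] Instance lebesgue_ae_filter {R : realType} :
  Filter (nbhs (almost_everywhere (@lebesgue_measure R))) :=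
  ae_filter_ringOfSetsType (@lebesgue_measure R).

Section RealSystem.
Context {R : realType}.
Implicit Types (c d x : R) (f g : R -> R).
Local Notation mu := (@lebesgue_measure R).

Lemma oint_segment (a : R) (b : \bar R) c d : oint a b c -> oint a b d ->
  `[c, d] `<=` oint a b.
Proof.
move=> [ac _] [_ db] x; rewrite /= in_itv /= => /andP[cx xd]; split.
  exact: lt_le_trans ac cx.
by apply: le_lt_trans db; rewrite lee_fin.
Qed.

(** The increments over a chain add up to the integral of [K] over the union of its intervals, which
    is small when the measure of that union is small. *)
Lemma acont_integral c d (K : R -> R) : (forall x, 0 <= K x) ->
  mu.-integrable setT (EFin \o K) ->
  acont c d (fun x => \int[mu]_(t in `]-oo, x]) K t).
Proof.
move=> K0 iK e e0; have [delta [delta0 H]] := integral_normr_continuous iK e0.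
exists delta => // L cL sL.
set F := fun x => \int[mu]_(t in `]-oo, x]) K t.
have iKS A : measurable A -> mu.-integrable A (EFin \o K).
  by move=> mA; apply: integrableS iK.
(* The inclusion in []-oo, d]] serves the induction: it makes the set built so far disjoint from the
   interval appended next. *)
have [A [mA _ muA ->]] : exists A : set R, [/\ measurable A,
    A `<=` `]-oo, d], mu A = (\sum_(i <- L) (i.2 - i.1))%:E &
    \sum_(i <- L) `|F i.2 - F i.1| = \int[mu]_(t in A) K t].
  elim/last_ind: L d cL {sL} => [|L [x y] IH] d' cL.
    exists set0; split=> //; first by rewrite big_nil measure0.
    by rewrite big_nil Rintegral_set0.
  have [xy yd cL'] : [/\ x <= y, y <= d' & chain c x L].
    move: cL; rewrite /chain all_rcons pairwise_rcons /= -!andbA.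
    case/and5P => cx xy yd aL /andP[pL ppL]; split=> //; apply/andP; split=> //.
    apply/allP => i iL /=; move/allP/(_ i iL): aL => /= /and3P[-> -> _].
    by move/allP/(_ i iL): pL.
  have [A [mA Ax muA sumA]] := IH _ cL'.
  have dis : A `&` `]x, y] = set0.
    apply/seteqP; split=> // t [/Ax]; rewrite /= !in_itv /= => tx /andP[xt _].
    by move: tx; rewrite leNgt xt.
  exists (A `|` `]x, y]); split; first exact: measurableU.
  - move=> t [/Ax|]; rewrite /= !in_itv /=; first by move=> tx; lra.
    by move=> /andP[_ ty]; lra.
  - rewrite measureU // big_rcons /= EFinD -muA; congr (_ + _)%E.
    rewrite lebesgue_measure_itv /= lte_fin; case: ltP => // *; congr _%:E; lra.
  - rewrite big_rcons /= sumA Rintegral_setU //; last 2 first.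
    + by apply: iKS; exact: measurableU.
    + by apply/disj_setPS; rewrite dis.
    congr (_ + _); rewrite /F (@Rintegral_itvB _ K -oo%O (BRight y)) //.
      by rewrite ger0_norm // Rintegral_ge0.
    by apply: iKS.
rewrite -[X in X < _](_ : \int[mu]_(t in A) `|K t| = _).
  by apply: H => //; rewrite -[X in (X < _)%E]/(mu A) muA lte_fin.
by apply: eq_Rintegral => t _; rewrite ger0_norm.
Qed.

(** Cut off outside [[c, d]], [K] is integrable on the line, and Lebesgue differentiation applies to
    its integral from [-oo]. The primitive becomes the exponent in the Gronwall argument. *)
Lemma acont_primitive c d (K : R -> R) : (forall x, 0 <= K x) ->
  mu.-integrable `[c, d] (EFin \o K) ->
  exists2 F : R -> R, acont c d F &
    {ae mu, forall x, c <= x <= d -> is_derive x (1 : R) F (K x)}.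
Proof.
move=> K0 iK; pose K1 := K \_ `[c, d].
have K10 x : 0 <= K1 x by rewrite /K1 patchE; case: ifP.
have iK1 : mu.-integrable setT (EFin \o K1).
  by rewrite /K1 -restrict_EFin -integrable_mkcond.
exists (fun x => \int[mu]_(t in `]-oo, x]) K1 t); first exact: acont_integral.
have iKy y : mu.-integrable `]-oo, y] (EFin \o K1) by exact: integrableS iK1.
have : locally_integrable setT K1 by exact: integrable_locally.
move/(FTC1Ny iKy).
apply: filterS => x [dx /[!derive1E] eqx] cxd.
have -> : K x = K1 x by rewrite /K1 patchE mem_set //= in_itv.
by rewrite -eqx; exact: derivableP.
Qed.

(** The system [f' = A g], [g' = B f]. With [A = 1/p] and [B = q - lambda r] it governs the real
    parts, and likewise the imaginary parts, of [u] and [pu']. *)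
Definition real_solution (a : R) (b : \bar R) (A B f g : R -> R) :=
  [/\ forall c d, oint a b c -> oint a b d -> c <= d -> acont c d f,
      forall c d, oint a b c -> oint a b d -> c <= d -> acont c d g,
      {ae mu, forall x, oint a b x -> is_derive x (1 : R) f (A x * g x)} &
      {ae mu, forall x, oint a b x -> is_derive x (1 : R) g (B x * f x)}].

Section Fixed.
Variables (a : R) (b : \bar R) (A B : R -> R).
Local Notation sol := (real_solution a b A B).

Lemma real_solution_lin k l f f1 g g1 : sol f f1 -> sol g g1 ->
  sol (fun x => k * f x + l * g x) (fun x => k * f1 x + l * g1 x).
Proof.
move=> [f2 f3 df df1] [g2 g3 dg dg1]; split.
- by move=> c d ? ? ?; apply: acontD; apply: acontZ; auto.
- by move=> c d ? ? ?; apply: acontD; apply: acontZ; auto.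
- apply: filterS2 df dg => x fx gx abx.
  have := is_deriveD (is_deriveZ k (fx abx)) (is_deriveZ l (gx abx)).
  by move/is_derive_eq; apply; rewrite /GRing.scale /=; ring.
- apply: filterS2 df1 dg1 => x fx gx abx.
  have := is_deriveD (is_deriveZ k (fx abx)) (is_deriveZ l (gx abx)).
  by move/is_derive_eq; apply; rewrite /GRing.scale /=; ring.
Qed.

(** The derivative of the Wronskian vanishes almost everywhere, since both products contribute the
    same terms [A f1 g1] and [B f g]. *)
Lemma real_wronskian_le c d f f1 g g1 : sol f f1 -> sol g g1 ->
  oint a b c -> oint a b d -> c <= d ->
  f c * g1 c - f1 c * g c <= f d * g1 d - f1 d * g d.
Proof.
move=> [f2 f3 df df1] [g2 g3 dg dg1] abc abd cd.
apply: (@acont_nondecreasing _ c d (fun x => f x * g1 x - f1 x * g x)) => //.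
  apply: acontD; first by apply: acontM; auto.
  have := @acontZ _ c d (-1) (fun x => f1 x * g x).
  rewrite (_ : (fun x => -1 * _) = fun x => - (f1 x * g x)).
    by apply; apply: acontM; auto.
  by apply/funext => x; rewrite mulN1r.
have dfg : {ae mu, forall x, oint a b x ->
    is_derive x (1 : R) f (A x * f1 x) /\ is_derive x (1 : R) f1 (B x * f x)}.
  by apply: filterS2 df df1 => x; split; auto.
have dgg : {ae mu, forall x, oint a b x ->
    is_derive x (1 : R) g (A x * g1 x) /\ is_derive x (1 : R) g1 (B x * g x)}.
  by apply: filterS2 dg dg1 => x; split; auto.
apply: filterS2 dfg dgg => x fx gx cxd.
have abx : oint a b x by apply: (oint_segment abc abd); rewrite /= in_itv.
have [fx1 fx2] := fx abx; have [gx1 gx2] := gx abx.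
exists 0 => //.
have := is_deriveB (is_deriveM fx1 gx2) (is_deriveM fx2 gx1).
by move/is_derive_eq; apply; rewrite /GRing.scale /=; ring.
Qed.

(** Exchanging the two solutions changes the sign of the Wronskian, so the inequality above also
    holds reversed. *)
Lemma real_wronskian_const f f1 g g1 : sol f f1 -> sol g g1 ->
  forall c d, oint a b c -> oint a b d ->
  f c * g1 c - f1 c * g c = f d * g1 d - f1 d * g d.
Proof.
move=> sf sg.
have key c d : oint a b c -> oint a b d -> c <= d ->
    f c * g1 c - f1 c * g c = f d * g1 d - f1 d * g d.
  move=> abc abd cd.
  have := real_wronskian_le sf sg abc abd cd.
  have := real_wronskian_le sg sf abc abd cd; lra.
move=> c d abc abd; have [cd|dc] := leP c d; first exact: key.
by apply/esym/key => //; exact: ltW.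
Qed.

Hypothesis AL : locally_integrable (oint a b) A.
Hypothesis BL : locally_integrable (oint a b) B.

Lemma integrable_segment (K : R -> R) c d :
  locally_integrable (oint a b) K -> oint a b c -> oint a b d ->
  mu.-integrable `[c, d] (EFin \o K).
Proof.
move=> [mK _ fK] abc abd; have sub := oint_segment abc abd.
apply/integrableP; split.
  apply/measurable_EFinP; apply: measurable_funS mK => //.
  by apply: open_measurable; case: AL.
exact: fK sub (@segment_compact _ _ _).
Qed.

(* Gronwall: with K = |A| + |B| one has |(f^2 + g^2)'| <= K (f^2 + g^2), so
   (f^2 + g^2) exp(-int K) is nonincreasing and (f^2 + g^2) exp(int K) is
   nondecreasing; [s] is the sign in the exponent. *)
Lemma real_solution_energy c d f g : sol f g ->
  oint a b c -> oint a b d -> c <= d -> exists F : R -> R, forall s, s ^+ 2 = 1 ->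
  s * (f c ^+ 2 + g c ^+ 2) * expR (s * F c) <=
  s * (f d ^+ 2 + g d ^+ 2) * expR (s * F d).
Proof.
move=> [acf acg df dg] abc abd cd.
pose K x := `|A x| + `|B x|.
have K0 x : 0 <= K x by rewrite addr_ge0.
have iK : mu.-integrable `[c, d] (EFin \o K).
  have -> : EFin \o K = ((fun x => `|(A x)%:E|) \+ (fun x => `|(B x)%:E|))%E by [].
  by apply: integrableD => //; apply: integrable_abse; exact: integrable_segment.
have [F acF dF] := acont_primitive K0 iK.
exists F => s s2.
apply: (@acont_nondecreasing _ c d
  (fun x => s * (f x ^+ 2 + g x ^+ 2) * expR (s * F x))) => //.
  apply: acontM => //; last by apply: acont_expR => //; exact: acontZ.
  by apply: acontZ; apply: acontD; apply: acontM; auto.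
have dfg : {ae mu, forall x, oint a b x ->
    is_derive x (1 : R) f (A x * g x) /\ is_derive x (1 : R) g (B x * f x)}.
  by apply: filterS2 df dg => x; split; auto.
apply: filterS2 dfg dF => x fx Fx cxd.
have abx : oint a b x by apply: (oint_segment abc abd); rewrite /= in_itv.
have [fx1 gx1] := fx abx; have {}Fx := Fx cxd.
exists (expR (s * F x) * (s * (2 * f x * g x * (A x + B x)) +
                    s ^+ 2 * K x * (f x ^+ 2 + g x ^+ 2))).
  have dE : is_derive x (1 : R) (fun x => expR (s * F x)) (s * K x * expR (s * F x)).
    have := @is_derive1_comp _ expR (s \*: F) x _ _
      (is_derive_expR (s * F x)) (is_deriveZ s Fx).
    by move/is_derive_eq; apply; rewrite /GRing.scale /=; ring.
  have := is_deriveM (is_deriveZ s (is_deriveD (is_deriveM fx1 fx1)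
    (is_deriveM gx1 gx1))) dE.
  move/is_derive_eq; apply; rewrite !fctE /GRing.scale /=.
  by rewrite -[s *: _]/(s * _); ring.
rewrite s2 mul1r; apply: mulr_ge0; first exact: expR_ge0.
have s1 : `|s| = 1 by apply/eqP; rewrite -sqrp_eq1 // real_normK ?num_real // s2.
have : `|s * (2 * f x * g x * (A x + B x))| <= K x * (f x ^+ 2 + g x ^+ 2).
  rewrite normrM s1 mul1r normrM mulrC ler_pM // ?ler_normD //.
  rewrite -mulrA normrM normrM ger0_norm //.
  have := sqr_ge0 (`|f x| - `|g x|).
  rewrite sqrrB !real_normK ?num_real // => ?; lra.
by move=> /ler_normlP[]; lra.
Qed.

(** The energy [f^2 + g^2] vanishes at [x0]. To the right of [x0] the sign [s = -1] keeps it from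
    growing out of zero, to the left [s = 1] does. *)
Lemma real_solution_unique f g x0 x : sol f g -> oint a b x0 -> oint a b x ->
  f x0 = 0 -> g x0 = 0 -> f x = 0 /\ g x = 0.
Proof.
move=> sfg ab0 abx f0 g0.
suff : f x ^+ 2 + g x ^+ 2 <= 0.
  move=> le0; have := sqr_ge0 (f x); have := sqr_ge0 (g x) => ? ?.
  by split; apply/eqP; rewrite -sqrf_eq0; apply/eqP; lra.
have [x0x|/ltW xx0] := leP x0 x.
  have [F HF] := real_solution_energy sfg ab0 abx x0x.
  have := HF (-1); rewrite sqrrN expr1n f0 g0 expr0n /= addr0 mulr0 mul0r.
  move=> /(_ erefl); rewrite mulN1r mulNr oppr_ge0 pmulr_lle0 //; exact: expR_gt0.
have [F HF] := real_solution_energy sfg abx ab0 xx0.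
have := HF 1; rewrite expr1n f0 g0 expr0n /= addr0 mulr0 mul0r mul1r.
move=> /(_ erefl); rewrite pmulr_lle0 //; exact: expR_gt0.
Qed.

End Fixed.
End RealSystem.

(** * Solutions and their Wronskian *)

Section ComplexSolutions.
Context {R : realType}.
Implicit Types (c d x : R) (z : R[i]) (u v : R -> R[i]).
Local Notation mu := (@lebesgue_measure R).

Lemma complex_ext z z' : complex.Re z = complex.Re z' ->
  complex.Im z = complex.Im z' -> z = z'.
Proof. by case: z z' => [x y] [x' y'] /= -> ->. Qed.

Lemma ReM z z' : complex.Re (z * z') =
  complex.Re z * complex.Re z' - complex.Im z * complex.Im z'.
Proof. by case: z z' => [x y] [x' y']. Qed.

Lemma ImM z z' : complex.Im (z * z') =
  complex.Re z * complex.Im z' + complex.Im z * complex.Re z'.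
Proof. by case: z z' => [x y] [x' y']. Qed.

Lemma ReB z z' : complex.Re (z - z') = complex.Re z - complex.Re z'.
Proof. by case: z z' => [x y] [x' y']. Qed.

Lemma ImB z z' : complex.Im (z - z') = complex.Im z - complex.Im z'.
Proof. by case: z z' => [x y] [x' y']. Qed.

Lemma ReD z z' : complex.Re (z + z') = complex.Re z + complex.Re z'.
Proof. by case: z z' => [x y] [x' y']. Qed.

Lemma ImD z z' : complex.Im (z + z') = complex.Im z + complex.Im z'.
Proof. by case: z z' => [x y] [x' y']. Qed.

Lemma abs2E z : abs2 z = complex.Re z ^+ 2 + complex.Im z ^+ 2.
Proof.
by case: z => x y; rewrite /abs2 /= sqr_sqrtr // addr_ge0 // sqr_ge0.
Qed.

Lemma normc_ge0 z : 0 <= Normc.normc z.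
Proof. by case: z => x y; exact: sqrtr_ge0. Qed.

Lemma normr_Re_le z : `|complex.Re z| <= Normc.normc z.
Proof.
by case: z => x y /=; rewrite -sqrtr_sqr ler_wsqrtr // lerDl sqr_ge0.
Qed.

Lemma normr_Im_le z : `|complex.Im z| <= Normc.normc z.
Proof.
by case: z => x y /=; rewrite -sqrtr_sqr ler_wsqrtr // lerDr sqr_ge0.
Qed.

(** [pr] is meant to be the real or the imaginary part; it is additive and does not enlarge
    increments. *)
Lemma abs_continuous_acont c d u (pr : R[i] -> R) :
  (forall z z', pr (z - z') = pr z - pr z') ->
  (forall z, `|pr z| <= Normc.normc z) ->
  abs_continuous c d u -> acont c d (pr \o u).
Proof.
move=> prB prle acu e /acu[delta delta0 H]; exists delta => // L.
move=> /andP[/allP aL /(pairwiseP (0, 0)) pL].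
rewrite !(big_nth (0, 0)) !big_mkord => sL.
pose s (i : 'I_(size L)) := (nth (0, 0) L i).1.
pose t (i : 'I_(size L)) := (nth (0, 0) L i).2.
apply: (@le_lt_trans _ _ (\sum_(i < size L) Normc.normc (u (t i) - u (s i)))).
  by apply: ler_sum => i _; rewrite /= -prB.
apply: H => // [i|i j].
  by have /and3P := aL _ (mem_nth (0, 0) (ltn_ord i)).
have key (k l : 'I_(size L)) : (k < l)%N -> t k <= s l.
  by move=> kl; apply: (pL k l); rewrite ?inE ?ltn_ord.
case: (ltngtP i j) => [/key tisj _|/key tjsi _|/val_inj ->]; last by rewrite eqxx.
  by left.
by right.
Qed.

Section Fixed.
Variables (a : R) (b : \bar R) (p q r : R -> R) (lambda : R).
Hypothesis p_gt0 : forall x, oint a b x -> 0 < p x.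
Local Notation A := (fun x => (p x)^-1).
Local Notation B := (fun x => q x - lambda * r x).
Local Notation csol := (is_solution a b p q r lambda%:C).
Local Notation rsol := (real_solution a b A B).

(** Since [p], [q], [r] and [lambda] are real, the equation does not mix real and imaginary
    parts. *)
Lemma is_solution_Re u u1 : csol u u1 ->
  rsol (fun x => complex.Re (u x)) (fun x => complex.Re (u1 x)).
Proof.
move=> [acu acu1 du du1]; split.
- move=> c d [ac _] [_ db] cd.
  exact: abs_continuous_acont ReB normr_Re_le (acu c d ac cd db).
- move=> c d [ac _] [_ db] cd.
  exact: abs_continuous_acont ReB normr_Re_le (acu1 c d ac cd db).
- apply: filterS du => x H abx; have [l [dl _] ->] := H abx.
  apply: is_derive_eq dl _; rewrite ReM /= mul0r subr0 mulKf //.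
  exact/lt0r_neq0/p_gt0.
- apply: filterS du1 => x H abx; have [l [dl _] /(congr1 (@complex.Re R))] := H abx.
  rewrite ReD !ReM /= => eql; apply: is_derive_eq dl _.
  by move: eql; case: l => /= ? ?; lra.
Qed.

Lemma is_solution_Im u u1 : csol u u1 ->
  rsol (fun x => complex.Im (u x)) (fun x => complex.Im (u1 x)).
Proof.
move=> [acu acu1 du du1]; split.
- move=> c d [ac _] [_ db] cd.
  exact: abs_continuous_acont ImB normr_Im_le (acu c d ac cd db).
- move=> c d [ac _] [_ db] cd.
  exact: abs_continuous_acont ImB normr_Im_le (acu1 c d ac cd db).
- apply: filterS du => x H abx; have [l [_ dl] ->] := H abx.
  apply: is_derive_eq dl _; rewrite ImM /= mul0r addr0 mulKf //.
  exact/lt0r_neq0/p_gt0.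
- apply: filterS du1 => x H abx; have [l [_ dl] /(congr1 (@complex.Im R))] := H abx.
  rewrite ImD !ImM /= => eql; apply: is_derive_eq dl _.
  by move: eql; case: l => /= ? ?; lra.
Qed.

(** The complex Wronskian is a combination of the four real Wronskians of real and imaginary parts,
    each of them constant. *)
Lemma wronskian_const u u1 v v1 c d : csol u u1 -> csol v v1 ->
  oint a b c -> oint a b d ->
  u c * v1 c - u1 c * v c = u d * v1 d - u1 d * v d.
Proof.
move=> su sv abc abd.
have [Ru Iu] := (is_solution_Re su, is_solution_Im su).
have [Rv Iv] := (is_solution_Re sv, is_solution_Im sv).
have RR := real_wronskian_const Ru Rv abc abd.
have RI := real_wronskian_const Ru Iv abc abd.
have IR := real_wronskian_const Iu Rv abc abd.
have II := real_wronskian_const Iu Iv abc abd.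
by apply: complex_ext; rewrite ?ReB ?ImB !(ReM, ImM); lra.
Qed.

Hypothesis AL : locally_integrable (oint a b) A.
Hypothesis qL : locally_integrable (oint a b) q.
Hypothesis rL : locally_integrable (oint a b) r.

Lemma locally_integrable_potential : locally_integrable (oint a b) B.
Proof.
have -> : B = q \+ (fun x => - lambda * r x).
  by apply/funext => x /=; rewrite mulNr.
apply: locally_integrableD qL _; have [mr oD fr] := rL.
split=> //; first exact: measurable_funM.
move=> K KD cK; have mK : measurable K by exact: compact_measurable.
have iK : mu.-integrable K (EFin \o r).
  apply/integrableP; split; last exact: fr.
  apply/measurable_EFinP; apply: measurable_funS mr => //.
  exact: open_measurable.
have /integrableP[] // : mu.-integrable K (fun x => (- lambda)%:E * (EFin \o r) x)%E.
by apply: integrableZl.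
Qed.

(** The real and imaginary parts of [c1 u + c2 v] are real combinations of real solutions ([sR] and
    [sI]) with zero data at [x0], so uniqueness applies. *)
Lemma lin_comb_eq0 u u1 v v1 (c1 c2 : R[i]) x0 : csol u u1 -> csol v v1 ->
  oint a b x0 -> c1 * u x0 + c2 * v x0 = 0 -> c1 * u1 x0 + c2 * v1 x0 = 0 ->
  forall x, oint a b x -> c1 * u x + c2 * v x = 0.
Proof.
move=> su sv ab0 e0 e1 x abx.
have [Ru Iu] := (is_solution_Re su, is_solution_Im su).
have [Rv Iv] := (is_solution_Re sv, is_solution_Im sv).
have lin := @real_solution_lin _ a b A B.
pose re := complex.Re; pose im := complex.Im.
have sR := lin 1 1 _ _ _ _ (lin (re R c1) (- im R c1) _ _ _ _ Ru Iu)
  (lin (re R c2) (- im R c2) _ _ _ _ Rv Iv).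
have sI := lin 1 1 _ _ _ _ (lin (re R c1) (im R c1) _ _ _ _ Iu Ru)
  (lin (re R c2) (im R c2) _ _ _ _ Iv Rv).
have uniq := real_solution_unique AL locally_integrable_potential.
have := (congr1 (@complex.Re R) e0, congr1 (@complex.Im R) e0).
have := (congr1 (@complex.Re R) e1, congr1 (@complex.Im R) e1).
rewrite !ReD !ImD !ReM !ImM /= => -[e1R e1I] [e0R e0I].
have [||xR _] := uniq _ _ x0 x sR ab0 abx; rewrite /re /im; [lra | lra |].
have [||xI _] := uniq _ _ x0 x sI ab0 abx; rewrite /re /im; [lra | lra |].
by apply: complex_ext; rewrite ?ReD ?ImD ?ReM ?ImM /=; move: xR xI;
  rewrite /re /im; lra.
Qed.

(** If the Wronskian vanished, the combinations with coefficients [(v, -u)] and [(v1, -u1)] taken at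
    [x0] would have zero data there. Independence then gives [u x0 = u1 x0 = 0], and the
    coefficients [(1, 0)] contradict it. *)
Lemma wronskian_neq0 u u1 v v1 x0 : csol u u1 -> csol v v1 ->
  lin_indep a b u v -> oint a b x0 -> u x0 * v1 x0 - u1 x0 * v x0 != 0.
Proof.
move=> su sv indep ab0; apply/eqP => w0.
have contra (c1 c2 : R[i]) : c1 * u x0 + c2 * v x0 = 0 -> c1 * u1 x0 + c2 * v1 x0 = 0 ->
    c1 = 0 /\ c2 = 0.
  by move=> e0 e1; apply: indep; exact: lin_comb_eq0 su sv ab0 e0 e1.
have [_ u0] : v x0 = 0 /\ - u x0 = 0.
  apply: contra; first by ring.
  by rewrite -[RHS]oppr0 -w0; ring.
have [_ u10] : v1 x0 = 0 /\ - u1 x0 = 0.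
  by apply: contra; [rewrite -[RHS]w0; ring | ring].
have [] : (1 : R[i]) = 0 /\ (0 : R[i]) = 0.
  apply: contra; rewrite mul0r addr0 mul1r; apply/eqP.
    by rewrite -oppr_eq0 u0.
  by rewrite -oppr_eq0 u10.
by move/eqP; rewrite oner_eq0.
Qed.

End Fixed.
End ComplexSolutions.

(** * Growth of solutions at the right end *)

Section LimitSuperior.
Context {R : realType}.
Implicit Types (F : set_system R) (f : R -> \bar R) (m : \bar R).

Lemma limf_esup_le F f m :
  (\forall x \near F, (f x <= m)%E) -> (limf_esup f F <= m)%E.
Proof.
move=> H; apply: ge_ereal_inf; exists (ereal_sup (f @` [set x | (f x <= m)%E])).
  by exists [set x | (f x <= m)%E].
by apply: ge_ereal_sup => _ [x /= fxm <-].
Qed.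

Lemma limf_esup_near_ge0 F f : ProperFilter F ->
  (\forall x \near F, (0 <= f x)%E) -> (0 <= limf_esup f F)%E.
Proof.
move=> PF H; apply: le_ereal_inf_tmp => _ [V FV <-].
have [x [Vx fx]] := filter_ex (filterI FV H).
by apply: le_trans fx _; apply: ereal_sup_ubound; exists x.
Qed.

Lemma limf_esup_lt F f m : Filter F -> (limf_esup f F < m)%E ->
  \forall x \near F, (f x <= m)%E.
Proof.
move=> FF /ereal_inf_lt[_ [V FV <-] Vm]; apply: filterS FV => x Vx.
by apply: ltW; apply: le_lt_trans Vm; apply: ereal_sup_ubound; exists x.
Qed.

End LimitSuperior.

(** * The filter at the right end *)

Section RightEnd.
Context {R : realType}.
Variables (a : R) (b : \bar R).
Hypothesis hab : (a%:E < b)%E.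

Lemma to_right_end_proper : ProperFilter (to_right_end b).
Proof.
by case: b hab => [c||] //= _; [exact: at_left_proper_filter | exact: proper_pinfty_nbhs].
Qed.

Lemma to_right_end_oint c : oint a b c ->
  \forall x \near to_right_end b, c < x /\ oint a b x.
Proof.
move=> [ac]; rewrite /oint; case: b => [d||] //=.
  rewrite lte_fin => cd.
  apply: filterS2 (nbhs_left_gt cd) (nbhs_left_lt d) => x cx xd.
  by rewrite lte_fin xd (lt_trans ac cx).
move=> _; apply: filterS (nbhs_pinfty_gt (num_real c)) => x cx.
by rewrite ltry (lt_trans ac cx).
Qed.

Lemma oint_nonempty : exists c, oint a b c.
Proof.
rewrite /oint; case: b hab => [d||] //=; last by exists (a + 1); rewrite ltry ltrDl.
rewrite lte_fin => ad; exists ((a + d) / 2); rewrite /= lte_fin.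
by split; lra.
Qed.

(** At [x = 0] the convention [0^-1 = 0] makes a bound on the mean say nothing about the norm. *)
Lemma to_right_end_neq0 : \forall x \near to_right_end b, x != 0.
Proof.
case: b hab => [d||] //= _; last first.
  by apply: filterS (nbhs_pinfty_gt (num_real 0)) => x x0; rewrite gt_eqF.
have [d0|d0] := ltP 0 d.
  by apply: filterS (nbhs_left_gt d0) => x x0; rewrite gt_eqF.
apply: filterS (nbhs_left_lt d) => x xd; rewrite lt_eqF //.
exact: lt_le_trans xd d0.
Qed.

End RightEnd.

(** * Measurability, positivity and monotonicity of the weighted norms; the integrated Wronskian *)

Section WeightedNorms.
Context {R : realType}.
Variables (a : R) (b : \bar R) (r : R -> R).
Implicit Types (u v : R -> R[i]) (x y : R).
Local Notation mu := (@lebesgue_measure R).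
Hypothesis r_gt0 : forall x, oint a b x -> 0 < r x.
Hypothesis mr : measurable_fun (oint a b) r.
Hypothesis oab : open (oint a b).

Lemma itv_oint x : oint a b x -> `]a, x[ `<=` oint a b.
Proof.
move=> [_ xb] y; rewrite /= in_itv /= => /andP[ay yx]; split=> //.
by apply: le_lt_trans xb; rewrite lee_fin ltW.
Qed.

Lemma acont_measurable (f : R -> R) :
  (forall c d, oint a b c -> oint a b d -> c <= d -> acont c d f) ->
  measurable_fun (oint a b) f.
Proof.
move=> acf; apply: open_continuous_measurable_fun => // x /[!inE] abx.
have [eta /= eta0 sub] := open_nbhs_nbhs (conj oab abx) : nbhs x (oint a b).
have abE (t : R) : `|x - t| < eta -> oint a b t by move=> ?; exact: sub.
have abc : oint a b (x - eta / 2).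
  by apply: abE; rewrite ltr_distl; apply/andP; split; lra.
have abd : oint a b (x + eta / 2).
  by apply: abE; rewrite ltr_distl; apply/andP; split; lra.
apply/cvgrPdist_lt => e e0.
have [|delta delta0 H] := acont_modulus (acf _ _ abc abd _) e0; first lra.
have m0 : 0 < Num.min (eta / 2) delta by rewrite lt_min delta0 divr_gt0.
apply: filterS (nbhsx_ballx x _ m0) => t.
rewrite /ball /= lt_min => /andP[].
rewrite [X in is_true X -> _]ltr_distl => /andP[t1 t2].
rewrite [X in is_true X -> _]ltr_distl => /andP[t3 t4].
have [xt|/ltW tx] := leP x t; first by rewrite distrC; apply: H; lra.
by apply: H; lra.
Qed.

Lemma measurable_inv_weight : measurable_fun (oint a b) (fun x => (r x)^-1).
Proof.
apply: (eq_measurable_fun (fun x => r x `^ (-1))).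
  by move=> x /[!inE] abx; rewrite powR_inv1 // ltW // r_gt0.
exact: (measurableT_comp (measurable_powR _)).
Qed.

Lemma measurable_sqnorm u x : measurable_fun (oint a b) (fun y => abs2 (u y)) ->
  oint a b x -> measurable_fun `]a, x[ (fun y => (abs2 (u y) * r y)%:E).
Proof.
move=> mu2 abx; apply/measurable_EFinP.
apply: (measurable_funS (open_measurable oab) (itv_oint abx)).
exact: measurable_funM.
Qed.

Lemma measurable_sqnorm_inv u x :
  measurable_fun (oint a b) (fun y => abs2 (u y)) ->
  oint a b x -> measurable_fun `]a, x[ (fun y => (abs2 (u y) / r y)%:E).
Proof.
move=> mu2 abx; apply/measurable_EFinP.
apply: (measurable_funS (open_measurable oab) (itv_oint abx)).
by apply: measurable_funM => //; exact: measurable_inv_weight.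
Qed.

Lemma sqnorm_integrand_ge0 u x y : oint a b x -> `]a, x[%classic y ->
  (0 <= (abs2 (u y) * r y)%:E)%E.
Proof.
move=> abx axy; rewrite lee_fin mulr_ge0 ?sqr_ge0 // ltW //.
exact/r_gt0/(itv_oint abx).
Qed.

Lemma sqnorm_inv_integrand_ge0 u x y : oint a b x -> `]a, x[%classic y ->
  (0 <= (abs2 (u y) / r y)%:E)%E.
Proof.
move=> abx axy; rewrite lee_fin divr_ge0 ?sqr_ge0 // ltW //.
exact/r_gt0/(itv_oint abx).
Qed.

Lemma sqnorm_ge0 u x : oint a b x -> (0 <= sqnorm a r u x)%E.
Proof. by move=> abx; apply: integral_ge0 => y; exact: sqnorm_integrand_ge0. Qed.

Lemma sqnorm_nondecreasing u x y :
  measurable_fun (oint a b) (fun y => abs2 (u y)) ->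
  oint a b y -> x <= y -> (sqnorm a r u x <= sqnorm a r u y)%E.
Proof.
move=> mu2 aby xy; apply: ge0_subset_integral => //.
- exact: measurable_sqnorm.
- by move=> t; exact: sqnorm_integrand_ge0.
- by apply: subset_itvl; rewrite bnd_simp.
Qed.

(** A zero norm forces [u = 0] almost everywhere on []a, y[], because [r > 0]. But [f], a real or
    imaginary part of [u], stays nonzero on an interval to the right of [x]. *)
Lemma sqnorm_gt0 u (f : R -> R) x y :
  measurable_fun (oint a b) (fun y => abs2 (u y)) ->
  (forall t, f t ^+ 2 <= abs2 (u t)) -> acont x y f -> f x != 0 ->
  oint a b x -> oint a b y -> x < y -> (0 < sqnorm a r u y)%E.
Proof.
move=> mu2 fu acf fx0 abx aby xy.
rewrite lt_neqAle sqnorm_ge0 // andbT; apply/eqP => int0.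
have : (\int[mu]_(t in `]a, y[) `|(abs2 (u t) * r t)%:E| = 0)%E.
  rewrite int0; apply: eq_integral => t /[!inE] ayt.
  by rewrite gee0_abs //; exact: sqnorm_integrand_ge0 ayt.
move/(ae_eq_integral_abs mu (measurable_itv _) (measurable_sqnorm mu2 aby)).
move=> [N [mN muN subN]].
have nf0 : 0 < `|f x| by rewrite normr_gt0.
have [delta delta0 H] := acont_modulus acf nf0.
pose z := Num.min y (x + delta).
have xz : x < z by rewrite lt_min xy ltrDl.
have zy : z <= y by rewrite ge_min lexx.
have zd : z <= x + delta by rewrite ge_min lexx orbT.
have ax : a < x by case: abx.
have sub : `]x, z[ `<=` N.
  move=> t; rewrite /= in_itv /= => /andP[xt tz]; apply: subN => /= H0.
  have ayt : `]a, y[%classic t.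
    by rewrite /= in_itv /= (lt_trans ax xt) (lt_le_trans tz zy).
  have /eqP := H0 ayt; rewrite eqe mulf_eq0.
  rewrite (gt_eqF (r_gt0 (itv_oint aby ayt))) orbF => /eqP u0.
  have := fu t; rewrite u0 => ft; have ft0 : f t = 0.
    by apply/eqP; rewrite -sqrf_eq0 eq_le ft sqr_ge0.
  have : `|f t - f x| < `|f x| by apply: H; lra.
  by rewrite ft0 sub0r normrN ltxx.
have : (mu `]x, z[ <= mu N)%E by apply: le_measure; rewrite ?inE.
rewrite lebesgue_measure_itv /= lte_fin xz -EFinD -[X in (_ <= X)%E]/(mu N) muN.
by rewrite lee_fin subr_le0 leNgt xz.
Qed.

(** Cauchy-Schwarz in the form of the weighted inequality [2 s t <= s^2 / k + k t^2], applied
    pointwise. This form remains meaningful when an integral is infinite, and leaves [k] free. *)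
Lemma wronskian_integral_bound u u1 v v1 (w : R[i]) (x k : R) :
  measurable_fun (oint a b) (fun y => abs2 (u y)) ->
  measurable_fun (oint a b) (fun y => abs2 (u1 y)) ->
  measurable_fun (oint a b) (fun y => abs2 (v y)) ->
  measurable_fun (oint a b) (fun y => abs2 (v1 y)) ->
  (forall y, oint a b y -> u y * v1 y - u1 y * v y = w) ->
  oint a b x -> 0 < k ->
  ((2 * Normc.normc w * (x - a))%:E <=
    k^-1%:E * (sqnorm a r u x + sqnorm_inv a r u1 x) +
    k%:E * (sqnorm a r v x + sqnorm_inv a r v1 x))%E.
Proof.
move=> mu0 mu1 mv0 mv1 Ew abx k0.
have := measurable_sqnorm mu0 abx; have := measurable_sqnorm_inv mu1 abx.
have := measurable_sqnorm mv0 abx; have := measurable_sqnorm_inv mv1 abx.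
move=> mi4 mi3 mi2 mi1.
have k0' : (0 <= k%:E)%E by rewrite lee_fin ltW.
have k1' : (0 <= k^-1%:E)%E by rewrite lee_fin invr_ge0 ltW.
have ge1 := @sqnorm_integrand_ge0 u x _ abx.
have ge2 := @sqnorm_inv_integrand_ge0 u1 x _ abx.
have ge3 := @sqnorm_integrand_ge0 v x _ abx.
have ge4 := @sqnorm_inv_integrand_ge0 v1 x _ abx.
rewrite /sqnorm /sqnorm_inv -!ge0_integralD //.
rewrite -!ge0_integralZl //; try exact: emeasurable_funD; last first.
  by move=> y axy; apply: adde_ge0; [exact: ge1 | exact: ge2].
  by move=> y axy; apply: adde_ge0; [exact: ge3 | exact: ge4].
rewrite -ge0_integralD //; first last.
- by apply: measurable_funeM; exact: emeasurable_funD.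
- by move=> y axy; apply: mule_ge0 => //; apply: adde_ge0; [exact: ge3 | exact: ge4].
- by apply: measurable_funeM; exact: emeasurable_funD.
- by move=> y axy; apply: mule_ge0 => //; apply: adde_ge0; [exact: ge1 | exact: ge2].
have ax : a < x by case: abx.
have -> : ((2 * Normc.normc w * (x - a))%:E =
    \int[mu]_(y in `]a, x[) (2 * Normc.normc w)%:E)%E.
  rewrite integral_cst // -[X in (_ * X)%E]/(mu `]a, x[).
  by rewrite lebesgue_measure_itv /= lte_fin ax -EFinD -EFinM.
apply: ge0_le_integral => //.
- by move=> y _; rewrite lee_fin mulr_ge0 // normc_ge0.
- by apply: emeasurable_funD; apply: measurable_funeM; exact: emeasurable_funD.
move=> y axy; have aby := itv_oint abx axy; have r0 := r_gt0 aby.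
rewrite /= -!(EFinD, EFinM) lee_fin -(Ew _ aby) /abs2.
have nw : Normc.normc (u y * v1 y - u1 y * v y) <=
    Normc.normc (u y) * Normc.normc (v1 y) + Normc.normc (u1 y) * Normc.normc (v y).
  rewrite -!Normc.normcM -[Normc.normc (u1 y * v y)]complex.normcN.
  exact: complex.le_normcD.
move: nw; set W := Normc.normc _; set U := Normc.normc (u y).
set U1 := Normc.normc (u1 y); set V := Normc.normc (v y).
set V1 := Normc.normc (v1 y) => nw.
(* The two squares whose cross terms are [-2 U V1] and [-2 U1 V]. *)
have sq1 : 0 <= k^-1 * r y * (U - k * V1 / r y) ^+ 2.
  by rewrite mulr_ge0 ?sqr_ge0 // mulr_ge0 ?invr_ge0 // ltW.
have sq2 : 0 <= k^-1 / r y * (U1 - k * V * r y) ^+ 2.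
  by rewrite mulr_ge0 ?sqr_ge0 // divr_ge0 ?invr_ge0 // ltW.
have -> : k^-1 * (U ^+ 2 * r y + U1 ^+ 2 / r y) + k * (V ^+ 2 * r y + V1 ^+ 2 / r y) =
    k^-1 * r y * (U - k * V1 / r y) ^+ 2 + k^-1 / r y * (U1 - k * V * r y) ^+ 2 +
    2 * (U * V1 + U1 * V).
  by field; rewrite !gt_eqF.
lra.
Qed.

End WeightedNorms.

(** An infinite [s] would stay infinite after multiplication by the nonzero [x^-1], so under the
    bound [fine] loses nothing. *)
Lemma mean_bounded_fin {R : realType} (x M : R) (s : \bar R) :
  x != 0 -> (0 <= s)%E -> (`|(x^-1)%:E * s| <= M%:E)%E ->
  s \is a fin_num /\ `|x^-1| * fine s <= M.
Proof.
move=> x0; case: s => [s||] //= s0.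
  by rewrite normrM (ger0_norm (_ : 0 <= s)) // -lee_fin.
rewrite abseM abse_EFin mulry gtr0_sg ?normr_gt0 ?invr_neq0 //.
by rewrite mul1e leye_eq.
Qed.

(** * Norms of solutions and their means near the right end *)

Section Solutions.
Context {R : realType}.
Variables (a : R) (b : \bar R) (p q r : R -> R) (lambda : R).
Implicit Types (u v : R -> R[i]) (x : R).
Hypothesis p_gt0 : forall x, oint a b x -> 0 < p x.
Hypothesis r_gt0 : forall x, oint a b x -> 0 < r x.
Hypothesis rL : locally_integrable (oint a b) r.
Local Notation csol := (is_solution a b p q r lambda%:C).

Lemma solution_measurable u u1 : csol u u1 ->
  measurable_fun (oint a b) (fun x => abs2 (u x)) /\
  measurable_fun (oint a b) (fun x => abs2 (u1 x)).
Proof.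
move=> su; have [_ oab _] := rL.
have [r0 r1 _ _] := is_solution_Re p_gt0 su.
have [i0 i1 _ _] := is_solution_Im p_gt0 su.
have sq (z : R -> R[i]) :
    measurable_fun (oint a b) (fun x => complex.Re (z x)) ->
    measurable_fun (oint a b) (fun x => complex.Im (z x)) ->
    measurable_fun (oint a b) (fun x => abs2 (z x)).
  move=> mR mI.
  rewrite (_ : (fun x => _) = (fun x => complex.Re (z x) ^+ 2 + complex.Im (z x) ^+ 2)).
    by apply: measurable_funD; exact: measurable_funX.
  by apply/funext => x; rewrite abs2E.
by split; apply: sq; exact: acont_measurable.
Qed.

Lemma solution_sqnorm_gt0 u u1 x y : csol u u1 -> oint a b x -> u x != 0 ->
  x < y -> oint a b y -> (0 < sqnorm a r u y)%E.
Proof.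
move=> su abx ux xy aby; have [mr oab _] := rL.
have [mu2 _] := solution_measurable su.
have [r0 _ _ _] := is_solution_Re p_gt0 su.
have [i0 _ _ _] := is_solution_Im p_gt0 su.
have [ru|ru] := eqVneq (complex.Re (u x)) 0; last first.
  apply: (sqnorm_gt0 r_gt0 mr oab mu2 _ (r0 _ _ abx aby (ltW xy)) ru) => // t.
  by rewrite abs2E lerDl sqr_ge0.
have iu : complex.Im (u x) != 0.
  by apply: contra ux => /eqP iu; apply/eqP/complex_ext.
apply: (sqnorm_gt0 r_gt0 mr oab mu2 _ (i0 _ _ abx aby (ltW xy)) iu) => // t.
by rewrite abs2E lerDr sqr_ge0.
Qed.

Hypothesis hab : (a%:E < b)%E.
Local Notation F := (to_right_end b).
Let PF : ProperFilter F := to_right_end_proper hab.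
#[local] Existing Instance PF.

Lemma near_solution_sqnorm_gt0 u u1 x : csol u u1 -> oint a b x -> u x != 0 ->
  \forall y \near F, (0 < sqnorm a r u y)%E.
Proof.
move=> su abx ux; apply: filterS (to_right_end_oint abx) => y [xy aby].
exact: solution_sqnorm_gt0 su abx ux xy aby.
Qed.

Lemma near_sqnorm_fin v M :
  (\forall x \near F, (`|(x^-1)%:E * sqnorm a r v x| <= M%:E)%E) ->
  \forall x \near F, sqnorm a r v x \is a fin_num /\
    `|x^-1| * fine (sqnorm a r v x) <= M.
Proof.
move=> bv; have [c abc] := oint_nonempty hab.
apply: filterS3 bv (to_right_end_neq0 hab) (to_right_end_oint abc).
move=> x bx x0 [_ abx]; apply: mean_bounded_fin => //.
exact: (sqnorm_ge0 r_gt0).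
Qed.

(** Write [||u||^2 / x] as [(||u|| / ||v||)^2] times the bounded [||v||^2 / x]. The bound [N] serves
    to make the norm of [u] finite, as [fine] would turn an infinite one into 0. *)
Lemma subordinate_mean_cvg0 u v M N :
  (\forall x \near F, (`|(x^-1)%:E * sqnorm a r u x| <= N%:E)%E) ->
  (\forall x \near F, (`|(x^-1)%:E * sqnorm a r v x| <= M%:E)%E) ->
  (\forall x \near F, (0 < sqnorm a r v x)%E) ->
  subordinate_wrt a b r u v -> forall e, 0 < e ->
  \forall x \near F, sqnorm a r u x \is a fin_num /\
    `|x^-1| * fine (sqnorm a r u x) <= e.
Proof.
move=> /near_sqnorm_fin bu /near_sqnorm_fin bv v0 sub e e0.
have M0 : 0 < `|M| + 1 by rewrite ltr_wpDl.
(* The square of this threshold, multiplied by the bound [M], is at most [e]. *)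
have d0 : 0 < Num.sqrt (e / (`|M| + 1)) by rewrite sqrtr_gt0 divr_gt0.
have [c abc] := oint_nonempty hab.
have /(_ _ _ d0) uv := proj1 (cvgrPdist_lt _ _) sub.
apply: filterS2 (filterI bu (to_right_end_oint abc)) (filterI (filterI bv v0) uv).
move=> x [[fu _] [_ abx]] [[[fv bvx] vx]]; rewrite /= sub0r normrN => uvx; split=> //.
have su0 : 0 <= fine (sqnorm a r u x) by rewrite fine_ge0 // (sqnorm_ge0 r_gt0).
have sv0 : 0 < fine (sqnorm a r v x) by rewrite fine_gt0 // vx ltey_eq fv.
have : norm_upto a r u x <= Num.sqrt (e / (`|M| + 1)) * norm_upto a r v x.
  rewrite -ler_pdivrMr ?sqrtr_gt0 //; apply: le_trans (ltW uvx).
  exact: ler_norm.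
have eM0 : 0 < e / (`|M| + 1) by exact: divr_gt0.
rewrite /norm_upto -(sqrtrM _ (ltW eM0)) ler_sqrt; last first.
  by rewrite mulr_ge0 // ltW.
move=> H; apply: (@le_trans _ _ (e / (`|M| + 1) * (`|x^-1| * fine (sqnorm a r v x)))).
  by rewrite mulrCA ler_wpM2l.
rewrite mulrAC ler_pdivrMr // ler_pM2l //.
by apply: (le_trans bvx); apply: le_trans (ler_norm _) _; rewrite lerDl.
Qed.

End Solutions.

Lemma lee_of_mean {R : realType} (x m : R) (s : \bar R) : 0 < x ->
  ((x^-1)%:E * s <= m%:E)%E -> (s <= (m * x)%:E)%E.
Proof.
move=> x0 H; rewrite -[s]mul1e -(divff (lt0r_neq0 x0)) EFinM -muleA mulrC EFinM.
by apply: lee_wpmul2l => //; rewrite lee_fin ltW.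
Qed.

(** * The contradictions for a finite and for an infinite right end *)

Section Contradiction.
Context {R : realType}.
Variables (a : R) (b : \bar R) (p q r : R -> R) (lambda : R).
Implicit Types (u v : R -> R[i]) (x : R).
Hypothesis p_gt0 : forall x, oint a b x -> 0 < p x.
Hypothesis r_gt0 : forall x, oint a b x -> 0 < r x.
Hypothesis rL : locally_integrable (oint a b) r.
Hypothesis hab : (a%:E < b)%E.
Local Notation csol := (is_solution a b p q r lambda%:C).
Local Notation F := (to_right_end b).
Let PF : ProperFilter F := to_right_end_proper hab.
#[local] Existing Instance PF.

(** Near a finite [c] the factor [x] is bounded, so means tending to 0 force the norm itself to 0,
    although it never falls below its positive value at [x2]. *)
Lemma mean_not_cvg0_finite (c : R) u u1 x1 : b = c%:E -> csol u u1 ->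
  oint a b x1 -> u x1 != 0 ->
  (forall e, 0 < e -> \forall x \near F, sqnorm a r u x \is a fin_num /\
    `|x^-1| * fine (sqnorm a r u x) <= e) -> False.
Proof.
move=> bc su ab1 ux1 cvg0; have [mr oab _] := rL.
have [mu2 _] := solution_measurable p_gt0 rL su.
have gt0 := near_solution_sqnorm_gt0 p_gt0 r_gt0 rL hab su ab1 ux1.
have [x2 [[[f2 _] s2] [_ ab2]]] :=
  filter_ex (filterI (filterI (cvg0 _ ltr01) gt0) (to_right_end_oint ab1)).
pose m := fine (sqnorm a r u x2).
have m0 : 0 < m by rewrite fine_gt0 // s2 ltey_eq f2.
have c0 : 0 < `|c| + 1 by rewrite ltr_wpDl.
(* Since [|x| <= |c| + 1] near [c], this bound on the mean makes the squared norm at most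
   [m / 2]. *)
have e0 : 0 < m / (2 * (`|c| + 1)) by rewrite divr_gt0 // mulr_gt0.
have near_c : \forall x \near F, `|x| <= `|c| + 1.
  have : \forall x \near c^'-, `|x| <= `|c| + 1.
    apply: filterS2 (nbhs_left_lt c) (nbhs_left_gt (_ : c - 1 < c)).
      move=> x xc cx; rewrite ler_norml; apply/andP.
      have := ler_norm c; have := ler_norm (- c); rewrite normrN => ? ?.
      by split; lra.
    lra.
  by rewrite bc.
have [x [[[fx bx] x0] [xc [x2x abx]]]] := filter_ex (filterI
  (filterI (cvg0 _ e0) (to_right_end_neq0 hab)) (filterI near_c (to_right_end_oint ab2))).
have : m <= fine (sqnorm a r u x).
  by apply: fine_le => //; apply: sqnorm_nondecreasing mu2 abx (ltW x2x).
have -> : fine (sqnorm a r u x) = `|x| * (`|x^-1| * fine (sqnorm a r u x)).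
  by rewrite mulrA -normrM divff // normr1 mul1r.
have : `|x| * (`|x^-1| * fine (sqnorm a r u x)) <=
    (`|c| + 1) * (m / (2 * (`|c| + 1))).
  apply: ler_pM => //.
  by rewrite mulr_ge0 // fine_ge0 // (sqnorm_ge0 r_gt0).
have -> : (`|c| + 1) * (m / (2 * (`|c| + 1))) = m / 2.
  by field; rewrite gt_eqF.
lra.
Qed.

(* Dividing the integrated Wronskian estimate by x makes its two terms
   O(e / k) and O(k), where e > 0 and k > 0 are arbitrary. *)
Lemma wronskian_eq0_infinite u u1 v v1 (w : R[i]) (M C D : R) :
  b = +oo%E -> csol u u1 -> csol v v1 ->
  (forall y, oint a b y -> u y * v1 y - u1 y * v y = w) ->
  (forall e, 0 < e -> \forall x \near F, sqnorm a r u x \is a fin_num /\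
    `|x^-1| * fine (sqnorm a r u x) <= e) ->
  (\forall x \near F, sqnorm a r v x \is a fin_num /\
    `|x^-1| * fine (sqnorm a r v x) <= M) ->
  (limf_esup (fun x : R => (x^-1)%:E * sqnorm_inv a r u1 x) F
     <= C%:E * limf_esup (fun x : R => (x^-1)%:E * sqnorm a r u x) F)%E ->
  (limf_esup (fun x : R => (x^-1)%:E * sqnorm_inv a r v1 x) F
     <= D%:E * limf_esup (fun x : R => (x^-1)%:E * sqnorm a r v x) F)%E ->
  w = 0.
Proof.
move=> boo su sv Ew cvg0 bv limu limv; have [mr oab _] := rL.
have [mu0 mu1] := solution_measurable p_gt0 rL su.
have [mv0 mv1] := solution_measurable p_gt0 rL sv.
have [c0 abc0] := oint_nonempty hab.
have near_gt (t : R) : \forall x \near F, t < x.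
  have : \forall x \near pinfty_nbhs R, t < x by apply: nbhs_pinfty_gt; exact: num_real.
  by rewrite boo.
have mean_le z m : (\forall x \near F, sqnorm a r z x \is a fin_num /\
      `|x^-1| * fine (sqnorm a r z x) <= m) ->
    \forall x \near F, ((x^-1)%:E * sqnorm a r z x <= m%:E)%E.
  move=> H; apply: filterS2 H (near_gt 0) => x [fx bx] x0.
  by rewrite -(fineK fx) -EFinM lee_fin -(gtr0_norm (_ : 0 < x^-1)) ?invr_gt0.
have lim_ge0 z :
    (0 <= limf_esup (fun x : R => (x^-1)%:E * sqnorm a r z x) F)%E.
  apply: limf_esup_near_ge0.
  apply: filterS2 (near_gt 0) (to_right_end_oint abc0) => x x0 [_ abx].
  by apply: mule_ge0; [rewrite lee_fin invr_ge0 ltW | exact: (sqnorm_ge0 r_gt0)].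
have lim0 : (limf_esup (fun x : R => (x^-1)%:E * sqnorm a r u x) F = 0)%E.
  apply/eqP; rewrite eq_le lim_ge0 andbT; apply/lee_addgt0Pr => e e0.
  by rewrite add0e; apply: limf_esup_le; apply: mean_le; exact: cvg0.
have inv_u e : 0 < e -> \forall x \near F,
    ((x^-1)%:E * sqnorm_inv a r u1 x <= e%:E)%E.
  move=> e0; apply: limf_esup_lt; apply: le_lt_trans limu _.
  by rewrite lim0 mule0 lte_fin.
have limM : (limf_esup (fun x : R => (x^-1)%:E * sqnorm a r v x) F <= M%:E)%E.
  by apply: limf_esup_le; exact: mean_le.
have [N inv_v] : exists N : R, \forall x \near F,
    ((x^-1)%:E * sqnorm_inv a r v1 x <= N%:E)%E.
  (* Finiteness turns the product with [D] into a real number; the added 1 in the witness makes the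
     inequality strict, as an eventual bound requires. *)
  have limfin : limf_esup (fun x : R => (x^-1)%:E * sqnorm a r v x)%E F \is a fin_num.
    by rewrite ge0_fin_numE // (le_lt_trans limM) // ltry.
  exists (D * fine (limf_esup (fun x : R => (x^-1)%:E * sqnorm a r v x)%E F) + 1).
  apply: limf_esup_lt; apply: le_lt_trans limv _.
  by rewrite -[X in (_ * X < _)%E](fineK limfin) -EFinM lte_fin ltrDl.
have key k : 0 < k -> Normc.normc w <= k * (2 + `|M| + `|N|).
  move=> k0; have k20 : 0 < k ^+ 2 by exact: exprn_gt0.
  (* The choice [e = k^2] makes the term with [k^-1] of order [k], like the other one. *)
  have [x [[[H1 H2] [H3 H4]] [[x0 xa] [_ abx]]]] := filter_ex (filterI (filterI
    (filterI (mean_le _ _ (cvg0 _ k20)) (inv_u _ k20))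
    (filterI (mean_le _ _ bv) inv_v))
    (filterI (filterI (near_gt 0) (near_gt (2 * `|a|))) (to_right_end_oint abc0))).
  have := wronskian_integral_bound r_gt0 mr oab mu0 mu1 mv0 mv1 Ew abx k0.
  have k0' : (0 <= k%:E)%E by rewrite lee_fin ltW.
  have k1' : (0 <= k^-1%:E)%E by rewrite lee_fin invr_ge0 ltW.
  move=> /le_trans /(_ (leeD
    (lee_wpmul2l k1' (leeD (lee_of_mean x0 H1) (lee_of_mean x0 H2)))
    (lee_wpmul2l k0' (leeD (lee_of_mean x0 H3) (lee_of_mean x0 H4))))).
  rewrite -!(EFinD, EFinM) lee_fin.
  have -> : k^-1 * (k ^+ 2 * x + k ^+ 2 * x) + k * (M * x + N * x) =
      k * (2 + M + N) * x by field; rewrite gt_eqF.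
  move=> H; rewrite -(ler_pM2r x0).
  (* [x > 2 |a|] gives [2 (x - a) >= x], which absorbs the left endpoint. *)
  have h1 : Normc.normc w * x <= 2 * Normc.normc w * (x - a).
    have : 0 <= Normc.normc w * (x - 2 * a).
      by apply: mulr_ge0; [exact: normc_ge0 | have := ler_norm a; lra].
    lra.
  have h2 : k * (2 + M + N) * x <= k * (2 + `|M| + `|N|) * x.
    rewrite ler_pM2r // ler_pM2l //.
    by have := ler_norm M; have := ler_norm N; lra.
  lra.
apply: Normc.eq0_normc; apply/eqP; rewrite eq_le normc_ge0 andbT.
apply/ler_addgt0Pr => e e0; rewrite add0r.
have K0 : 0 < 2 + `|M| + `|N| by have := normr_ge0 M; have := normr_ge0 N; lra.
by have := key _ (divr_gt0 e0 K0); rewrite divfK // gt_eqF.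
Qed.

End Contradiction.

Theorem lemma2p6 (R : realType) (a : R) (b : \bar R) (p q r : R -> R)
    (lambda : R)
    (hab : (a%:E < b)%E)
    (hp : forall x, oint a b x -> 0 < p x)
    (hr : forall x, oint a b x -> 0 < r x)
    (hpL1 : locally_integrable (oint a b) (fun x => (p x)^-1))
    (hqL1 : locally_integrable (oint a b) q)
    (hrL1 : locally_integrable (oint a b) r)
    (ha : regular_left a b p q r)
    (hb : limit_point_right a b p q r)
    (hlimsup : forall u pu' : R -> R[i],
      is_solution a b p q r lambda%:C u pu' ->
      exists C : R,
        (limf_esup (fun x : R => (x^-1)%:E * sqnorm_inv a r pu' x)
           (to_right_end b)
         <= C%:E * limf_esup (fun x : R => (x^-1)%:E * sqnorm a r u x)
              (to_right_end b))%E)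
    (hbdd : forall u : R -> R[i],
      solution a b p q r lambda%:C u ->
      exists M : R, \forall x \near to_right_end b,
        (`| (x^-1)%:E * sqnorm a r u x | <= M%:E)%E) :
  N_tau a b p q r lambda.
Proof.
move=> [u [[u1 su] [x1 ab1 ux1] [v [[v1 sv] indep sub]]]].
have [[N bu] [M bv]] := (hbdd _ (ex_intro _ _ su), hbdd _ (ex_intro _ _ sv)).
(* If [v] vanished identically, the coefficients [(0, 1)] would violate independence. *)
have [x2 ab2 vx2] : exists2 x, oint a b x & v x != 0.
  apply: contrapT => v0; have [|_ /eqP] := indep 0 1; last by rewrite oner_eq0.
  move=> x abx; rewrite mul0r add0r mul1r; apply/eqP/negPn/negP => vx.
  by apply: v0; exists x.
have v_gt0 := near_solution_sqnorm_gt0 hp hr hrL1 hab sv ab2 vx2.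
have cvg0 := subordinate_mean_cvg0 hr hab bu bv v_gt0 sub.
have bv' := near_sqnorm_fin hr hab bv.
have w_neq0 := wronskian_neq0 hp hpL1 hqL1 hrL1 su sv indep ab1.
case bE : b => [c||].
- exact: mean_not_cvg0_finite hp hr hrL1 hab c u u1 x1 bE su ab1 ux1 cvg0.
- have [C limu] := hlimsup _ _ su; have [D limv] := hlimsup _ _ sv.
  move/eqP: w_neq0; apply.
  apply: (wronskian_eq0_infinite hp hr hrL1 hab bE su sv _ cvg0 bv' limu limv).
  by move=> y aby; exact (wronskian_const hp su sv aby ab1).
- by move: hab; rewrite bE.
Qed.
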